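(* Let $T = K + M$ be an integral domain, where the field $K$ is a subring of $T$ and $M$ is a nonzero maximal ideal of $T$, and let $D$ be a subring of $K$ and $R = D + M$. (a) Let $I$ be an ideal of $D$. Then $I + M$ is an sdf-absorbing ideal of $R$ if and only if $I$ is an sdf-absorbing ideal of $D$. (b) Let $T$ be a valuation domain, and let $J$ be an ideal of $R$. Then $J$ is an sdf-absorbing ideal of $R$ if and only if $J = I + M$ for some sdf-absorbing ideal $I$ of $D$, or $J$ is a prime ideal of $T$.
   Context: All rings are commutative with identity $1 \neq 0$, and subrings share the identity. A proper ideal $I$ of a commutative ring $R$ is a square-difference factor absorbing ideal (sdf-absorbing ideal) of $R$ if whenever $a, b \in R$ are both nonzero and $a^2 - b^2 \in I$, then $a + b \in I$ or $a - b \in I$. Here $R = D + M = \{d + m \mid d \in D, m \in M\}$ is a subring of $T$, and $I + M = \{i + m \mid i \in I, m \in M\}$. *)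

(* Defs.v *)
From HB Require Import structures.
From mathcomp Require Import all_boot all_algebra.
From mathcomp Require Import classical_sets.

Set Implicit Arguments.
Unset Strict Implicit.
Unset Printing Implicit Defensive.

Import GRing.Theory.
Local Open Scope ring_scope.
Local Open Scope classical_set_scope.

(* The rings D, K and R = D + M are subrings of one ambient ring A, so the
   ideal-theoretic notions are relative to a subset S of A, which is meant to
   be a subring; S = setT gives the notion for A itself. *)

Definition subring (A : comNzRingType) (S : set A) : Prop :=
  subring_closed (mem S).

(* divring_closed would not do: x^-1 = x when x is not a unit. *)
Definition subfield (A : comNzRingType) (K : set A) : Prop :=
  subring K /\
  forall x, K x -> x <> 0 -> exists2 y, K y & x * y = 1.

Definition sumset (A : comNzRingType) (X Y : set A) : set A :=
  [set x + y | x in X & y in Y].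

(* Not necessarily proper, unlike idealr_closed. *)
Definition ideal (A : comNzRingType) (S I : set A) : Prop :=
  [/\ I `<=` S,
      I 0,
      forall x y, I x -> I y -> I (x + y)
    & forall s x, S s -> I x -> I (s * x)].

Definition proper_ideal (A : comNzRingType) (S I : set A) : Prop :=
  ideal S I /\ I <> S.

Definition prime_ideal (A : comNzRingType) (S P : set A) : Prop :=
  proper_ideal S P /\
  forall x y, S x -> S y -> P (x * y) -> P x \/ P y.

Definition maximal_ideal (A : comNzRingType) (S M : set A) : Prop :=
  proper_ideal S M /\
  forall J, proper_ideal S J -> M `<=` J -> J = M.

Definition sdf_absorbing_ideal (A : comNzRingType) (S I : set A) : Prop :=
  proper_ideal S I /\
  forall a b, S a -> S b -> a <> 0 -> b <> 0 ->
    I (a ^+ 2 - b ^+ 2) -> I (a + b) \/ I (a - b).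

Definition valuation_domain (T : idomainType) : Prop :=
  forall x : {fraction T}, x <> 0 ->
    (exists t : T, x = tofrac t) \/ (exists t : T, x^-1 = tofrac t).

(* Main.v *)
Require Import Defs.
From mathcomp Require Import all_boot all_algebra.
From mathcomp Require Import classical_sets.
From mathcomp Require Import boolp ring.

(** Two facts link the sdf-absorbing condition to better known ones.  First, an
    sdf-absorbing ideal [J] of a domain is radical ([sdf_absorbing_radical]): if
    [x ^+ 2] lies in [J] and [i] is a nonzero element of [J], the condition
    for the pair [x], [i] puts [x] in [J]; the zero ideal is radical anyway.
    Second, a prime ideal is sdf-absorbing because [a ^+ 2 - b ^+ 2] factors as
    [(a - b) * (a + b)].

    Since [K] is a field and [M] is proper, [K] meets [M] in [0], so an element
    of [R] is [d + m] for a unique pair, and it lies in [I + M] iff [d] lies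
    in [I]; also [(d + m) ^+ 2] is [d ^+ 2] modulo [M].  The condition for
    [I + M] in [R] thus becomes the condition for [I] in [D], except that
    [d + m] may be nonzero while [d] is zero; for such pairs, radicality
    of [I] gives the conclusion.

    In (b), the elements of a valuation domain [T] are pairwise comparable for
    divisibility, so [T] is local with maximal ideal [M].  An ideal [J] of [R]
    that is not inside [M] contains a unit of [T], hence all of [M]
    ([ideal_in_or_contains_max]), hence is [I + M] with [I] the trace of [J]
    on [D], and (a) applies.  An ideal [J] inside [M] that is
    sdf-absorbing is radical.  It is then stable under multiplication by [T],
    for [(t * x) ^+ 2] is the product of [x] by the element [t ^+ 2 * x] of [M],
    and [M] is part of [R].  Finally, a radical ideal of a valuation domain is
    prime: if [x] divides [y] and [x * y] is in [J], then so is [y ^+ 2]. *)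

Set Implicit Arguments.
Unset Strict Implicit.
Unset Printing Implicit Defensive.

Import GRing.Theory.
Local Open Scope ring_scope.
Local Open Scope classical_set_scope.

(** * Subrings and ideals relative to a subset *)

Lemma subring1 (A : comNzRingType) (S : set A) : subring S -> S 1.
Proof. by case=> + _ _; rewrite inE. Qed.

Lemma subringB (A : comNzRingType) (S : set A) (x y : A) :
  subring S -> S x -> S y -> S (x - y).
Proof. by case=> _ SB _ Sx Sy; have := SB x y; rewrite !inE; apply. Qed.

Lemma subringM (A : comNzRingType) (S : set A) (x y : A) :
  subring S -> S x -> S y -> S (x * y).
Proof. by case=> _ _ SM Sx Sy; have := SM x y; rewrite !inE; apply. Qed.

Lemma subring0 (A : comNzRingType) (S : set A) : subring S -> S 0.
Proof. by move=> hS; rewrite -(subrr 1); apply: subringB => //; exact: subring1. Qed.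

Lemma subringN (A : comNzRingType) (S : set A) (x : A) :
  subring S -> S x -> S (- x).
Proof. by move=> hS Sx; rewrite -sub0r; apply: subringB => //; exact: subring0. Qed.

Lemma subringD (A : comNzRingType) (S : set A) (x y : A) :
  subring S -> S x -> S y -> S (x + y).
Proof.
by move=> hS Sx Sy; rewrite -(opprK y); apply: subringB => //; exact: subringN.
Qed.

Lemma subring_setT (A : comNzRingType) : subring [set: A].
Proof. by split=> [|x y _ _|x y _ _]; rewrite inE. Qed.

Lemma idealN (A : comNzRingType) (S I : set A) (x : A) :
  subring S -> ideal S I -> I x -> I (- x).
Proof.
by move=> hS [_ _ _ IM] Ix; rewrite -mulN1r; apply: IM => //;
   apply: subringN => //; exact: subring1.
Qed.

Lemma idealB (A : comNzRingType) (S I : set A) (x y : A) :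
  subring S -> ideal S I -> I x -> I y -> I (x - y).
Proof. by move=> hS hI Ix Iy; case: (hI) => _ _ ID _; apply/ID/(idealN hS). Qed.

Lemma proper_ideal1 (A : comNzRingType) (S I : set A) :
  Defs.proper_ideal S I -> ~ I 1.
Proof.
move=> [[IS _ _ IM] IneqS] I1; apply: IneqS; apply/seteqP; split=> // x Sx.
by rewrite -(mulr1 x); apply: IM.
Qed.

Lemma proper_idealP (A : comNzRingType) (S I : set A) :
  subring S -> ideal S I -> ~ I 1 -> Defs.proper_ideal S I.
Proof. by move=> ? ? I1; split=> // eqIS; apply: I1; rewrite eqIS; exact: subring1. Qed.

(** * Sdf-absorbing ideals of a domain *)

(** When the ideal has a nonzero element [i], this follows from the
    condition for the pair [x], [i]; the zero ideal of a domain is prime. *)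
Lemma sdf_absorbing_radical (T : idomainType) (S J : set T) (x : T) :
  subring S -> sdf_absorbing_ideal S J -> S x -> J (x ^+ 2) -> J x.
Proof.
move=> hS [[hJ _] sdfJ] Sx Jx2; case: (hJ) => JS J0 JD JM.
have [->//|/eqP x0] := eqVneq x 0.
have [[i [Ji i0]]|J_trivial] := pselect (exists i, J i /\ i <> 0).
  have Ji2 : J (i ^+ 2) by rewrite expr2; apply: JM => //; exact: JS.
  have [Jxi|Jxi] := sdfJ x i Sx (JS _ Ji) x0 i0 (idealB hS hJ Jx2 Ji2).
    by rewrite -(addrK i x); apply: (idealB hS hJ).
  by rewrite -(subrK i x); apply: JD.
case: J_trivial; exists (x ^+ 2); split=> //.
by apply/eqP; rewrite sqrf_eq0; apply/eqP.
Qed.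

(** The subring [S] need not be the whole ring, so this applies to an ideal that
    is prime in an overring of [S] and happens to be contained in [S]. *)
Lemma prime_sdf_absorbing (A : comNzRingType) (S J : set A) :
  subring S -> ideal S J -> prime_ideal [set: A] J -> sdf_absorbing_ideal S J.
Proof.
move=> hS hJ [properJ primeJ]; split.
  by apply: proper_idealP => //; exact: proper_ideal1 properJ.
by move=> a b _ _ _ _; rewrite subr_sqr => /(primeJ _ _ I I) [|]; [right|left].
Qed.

(** * The ring D + M *)

Lemma subfield_cap_proper (A : comNzRingType) (K M : set A) (x : A) :
  subfield K -> Defs.proper_ideal [set: A] M -> K x -> M x -> x = 0.
Proof.
move=> [_ invK] properM Kx Mx; apply: contrapT => x0.
have [y _ xy1] := invK x Kx x0; apply: (proper_ideal1 properM).
by case: (properM) => [[_ _ _ MM] _]; rewrite -xy1 mulrC; apply: MM.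
Qed.

(** The decomposition of an element of [K + M] is unique, so its first component
    decides membership in [I + M]. *)
Lemma sumset_memE (A : comNzRingType) (K M D I : set A) (d m : A) :
  subfield K -> Defs.proper_ideal [set: A] M -> D `<=` K -> I `<=` D ->
  D d -> M m -> sumset I M (d + m) <-> I d.
Proof.
move=> hK properM DK ID Dd Mm; split=> [[i Ii [n Mn dm]]|Id]; last first.
  by exists d => //; exists m.
have diE : d - i = n - m.
  by apply/eqP; rewrite subr_eq addrAC [n + i]addrC dm addrK.
suff /eqP : d - i = 0 by rewrite subr_eq0 => /eqP ->.
apply: (subfield_cap_proper hK properM).
  by apply: subringB; [case: hK|exact: DK|exact/DK/ID].
by rewrite diE; case: properM => hM _; apply: (idealB (@subring_setT A) hM).
Qed.

Lemma sumset_subring (A : comNzRingType) (D M : set A) :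
  subring D -> ideal [set: A] M -> subring (sumset D M).
Proof.
move=> hD hM; case: (hM) => _ M0 MD MM; split; rewrite ?inE.
- by exists 1; [exact: subring1|exists 0; rewrite ?addr0].
- move=> _ _ /[!inE] -[d Dd [m Mm <-]] [e De [n Mn <-]].
  exists (d - e); first exact: subringB.
  exists (m - n); first exact: (idealB (@subring_setT A) hM).
  by rewrite opprD addrACA.
- move=> _ _ /[!inE] -[d Dd [m Mm <-]] [e De [n Mn <-]].
  exists (d * e); first exact: subringM.
  exists (d * n + (e + n) * m); first by apply: MD; apply: MM.
  by ring.
Qed.

Lemma sumset_ideal (A : comNzRingType) (D M I : set A) :
  ideal [set: A] M -> ideal D I -> ideal (sumset D M) (sumset I M).
Proof.
move=> [_ M0 MD MM] [ID I0 IA IM]; split.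
- by move=> _ [i Ii [m Mm <-]]; exists i; [exact: ID|exists m].
- by exists 0 => //; exists 0; rewrite ?addr0.
- move=> _ _ [i Ii [m Mm <-]] [j Ij [n Mn <-]].
  by exists (i + j); [exact: IA|exists (m + n); [exact: MD|rewrite addrACA]].
- move=> _ _ [d Dd [m Mm <-]] [i Ii [n Mn <-]].
  exists (d * i); first exact: IM.
  exists (d * n + (i + n) * m); first by apply: MD; apply: MM.
  by ring.
Qed.

Lemma sumset_sdf_absorbing (T : idomainType) (K M D I : set T) :
  subfield K -> Defs.proper_ideal [set: T] M -> subring D -> D `<=` K ->
  ideal D I ->
  sdf_absorbing_ideal (sumset D M) (sumset I M) <-> sdf_absorbing_ideal D I.
Proof.
move=> hK properM hD DK hI.
have hM : ideal [set: T] M by case: properM.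
have [_ M0 MD MM] := hM; have [ID I0 IA IM] := hI.
have memE d m : D d -> M m -> sumset I M (d + m) <-> I d.
  exact: (sumset_memE hK properM).
have memE0 d : D d -> sumset I M d <-> I d.
  by move=> Dd; rewrite -[X in sumset _ _ X]addr0; exact: memE.
have subset d : D d -> sumset D M d.
  by move=> Dd; exists d => //; exists 0; rewrite ?addr0.
have D1 := subring1 hD.
split=> [[properIM sdfIM]|sdfI].
  split.
    by apply: proper_idealP => // /(memE0 _ D1).2; exact: proper_ideal1 properIM.
  move=> a b Da Db a0 b0 Iab.
  have Dab : D (a ^+ 2 - b ^+ 2) by exact: ID.
  have := sdfIM a b (subset _ Da) (subset _ Db) a0 b0 ((memE0 _ Dab).2 Iab).
  by case=> [/(memE0 _ (subringD hD Da Db))|/(memE0 _ (subringB hD Da Db))];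
    [left|right].
have [properI sdf] := sdfI; split.
  apply: proper_idealP; [exact: sumset_subring|exact: sumset_ideal|].
  by move/(memE0 _ D1).1; exact: proper_ideal1 properI.
move=> _ _ [a Da [m Mm <-]] [b Db [n Mn <-]] _ _.
have -> : (a + m) ^+ 2 - (b + n) ^+ 2
    = (a ^+ 2 - b ^+ 2) + ((a + a + m) * m - (b + b + n) * n) by ring.
have Dab : D (a ^+ 2 - b ^+ 2).
  by rewrite !expr2; apply: subringB => //; exact: subringM.
have Mab : M ((a + a + m) * m - (b + b + n) * n).
  by apply: (idealB (@subring_setT T) hM); apply: MM.
move=> /(memE _ _ Dab Mab) Iab.
suff [Iab'|Iab'] : I (a + b) \/ I (a - b).
- left; rewrite addrACA; apply/memE => //; first exact: subringD.
  exact: MD.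
- right; rewrite opprD addrACA; apply/memE => //; first exact: subringB.
  exact: (idealB (@subring_setT T) hM).
(* The condition on I says nothing when a or b vanishes, as may happen for
   nonzero a + m and b + n; the square of the other one is then in I. *)
have rad x : D x -> I (x ^+ 2) -> I x.
  exact: (sdf_absorbing_radical hD sdfI).
have [a0|/eqP a0] := eqVneq a 0.
  left; rewrite a0 add0r; apply: rad => //.
  by move: (idealN hD hI Iab); rewrite a0 expr0n sub0r opprK.
have [b0|/eqP b0] := eqVneq b 0.
  by left; rewrite b0 addr0; apply: rad => //; move: Iab; rewrite b0 expr0n subr0.
exact: sdf.
Qed.

(** * Valuation domains *)

Lemma valuation_domain_dvd (T : idomainType) (x y : T) :
  valuation_domain T -> (exists t, y = t * x) \/ (exists t, x = t * y).
Proof.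
move=> valT.
have [->|x0] := eqVneq x 0; first by right; exists 0; rewrite mul0r.
have [->|y0] := eqVneq y 0; first by left; exists 0; rewrite mul0r.
have fx0 : tofrac x != 0 by rewrite tofrac_eq0.
have fy0 : tofrac y != 0 by rewrite tofrac_eq0.
have [|[t]|[t]] := valT (tofrac y / tofrac x).
- by apply/eqP; rewrite mulf_neq0 ?invr_eq0.
- move=> e; left; exists t; apply/eqP; rewrite -tofrac_eq tofracM -e.
  by rewrite divfK.
- rewrite invf_div => e; right; exists t; apply/eqP; rewrite -tofrac_eq tofracM -e.
  by rewrite divfK.
Qed.

(** Comparing [x] and [y], one of them divides the other, whose square is
    then a multiple of the product. *)
Lemma radical_prime (T : idomainType) (J : set T) :
  valuation_domain T -> Defs.proper_ideal [set: T] J ->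
  (forall x, J (x ^+ 2) -> J x) -> prime_ideal [set: T] J.
Proof.
move=> valT properJ radJ; have [[_ _ _ JM] _] := properJ.
split=> // x y _ _ Jxy; case: (valuation_domain_dvd x y valT) => -[t e].
  by right; apply: radJ; rewrite expr2 {1}e -mulrA; apply: JM.
by left; apply: radJ; rewrite expr2 {2}e mulrCA; apply: JM.
Qed.

(** An element outside [M] is [k + m] with [k] a nonzero element of [K].  If it
    divides [m], it divides the unit [k]; otherwise it is a multiple of [m], and
    so lies in [M]. *)
Lemma valuation_local (T : idomainType) (K M : set T) (x : T) :
  subfield K -> Defs.proper_ideal [set: T] M -> [set: T] = sumset K M ->
  valuation_domain T -> ~ M x -> exists y, y * x = 1.
Proof.
move=> [_ invK] properM TKM valT; have [[_ _ MD MM] _] := properM.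
have : [set: T] x by [].
rewrite TKM => -[k Kk [m Mm <-]] nMx.
have k0 : k <> 0 by move=> k0; apply: nMx; rewrite k0 add0r.
have [l _ kl] := invK k Kk k0.
case: (valuation_domain_dvd (k + m) m valT) => -[t e].
  exists (l * (1 - t)); rewrite -mulrA mulrBl mul1r -e addrK.
  by rewrite mulrC.
by case: nMx; rewrite e; apply: MM.
Qed.

(** An element of [J] outside [M] has an inverse [y] in [T], and [M] is made of
    the products of this element by the members of [y * M], which are in
    [R]. *)
Lemma ideal_in_or_contains_max (T : idomainType) (K M R J : set T) :
  subfield K -> Defs.proper_ideal [set: T] M -> [set: T] = sumset K M ->
  valuation_domain T -> M `<=` R -> ideal R J -> J `<=` M \/ M `<=` J.
Proof.
move=> hK properM TKM valT MR [_ _ _ JM]; have [[_ _ _ MM] _] := properM.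
have [|/existsNP[x /not_implyP[Jx nMx]]] := pselect (J `<=` M); first by left.
have [y yx] := valuation_local hK properM TKM valT nMx.
right=> n Mn; rewrite -(mul1r n) -yx mulrAC; apply: JM => //.
by apply: MR; apply: MM.
Qed.

Lemma ideal_containing_max (A : comNzRingType) (D M J : set A) :
  ideal [set: A] M -> subring D -> ideal (sumset D M) J -> M `<=` J ->
  ideal D (D `&` J) /\ J = sumset (D `&` J) M.
Proof.
move=> hM hD hJ MJ; have [JR J0 JA JM] := hJ; have [_ M0 _ _] := hM; split.
  split=> [x []//||x y [Dx Jx] [Dy Jy]|s x Ds [Dx Jx]].
  - by split=> //; exact: subring0.
  - by split; [exact: subringD|exact: JA].
  - split; first exact: subringM.
    by apply: JM => //; exists s => //; exists 0; rewrite ?addr0.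
apply/seteqP; split=> [x Jx|_ [d [_ Jd] [m Mm <-]]]; last exact/JA/MJ.
have [d Dd [m Mm dmx]] := JR x Jx.
exists d; last by exists m.
split=> //; rewrite -(addrK m d) dmx.
by apply: (idealB (sumset_subring hD hM) hJ) => //; exact: MJ.
Qed.

(** Radicality in [R] is enough for an ideal inside [M], as squares in
    [J] come from [M], hence from [R]: for [t] in [T] and [x] in [J],
    the square of [t * x] is a multiple of [x] by an element of [M]. *)
Lemma radical_sub_max_prime (T : idomainType) (M R J : set T) :
  valuation_domain T -> prime_ideal [set: T] M -> M `<=` R -> ideal R J ->
  J `<=` M -> (forall x, R x -> J (x ^+ 2) -> J x) -> prime_ideal [set: T] J.
Proof.
move=> valT [properM primeM] MR [_ J0 JA JM] JsubM radR.
have [[_ _ _ MM] _] := properM.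
have rad x : J (x ^+ 2) -> J x.
  move=> Jx2; apply: radR => //; apply: MR.
  by have := JsubM _ Jx2; rewrite expr2 => /(primeM _ _ I I)[].
apply: radical_prime => //; apply: proper_idealP; first exact: subring_setT.
  split=> // t x _ Jx; apply: rad; rewrite exprMn [x ^+ 2]expr2 mulrA.
  by apply: JM => //; apply: MR; apply: MM => //; exact: JsubM.
by move=> /JsubM; exact: proper_ideal1 properM.
Qed.

(** A factor outside [M] is a unit, so it can be cancelled. *)
Lemma valuation_max_prime (T : idomainType) (K M : set T) :
  subfield K -> Defs.proper_ideal [set: T] M -> [set: T] = sumset K M ->
  valuation_domain T -> prime_ideal [set: T] M.
Proof.
move=> hK properM TKM valT; have [[_ _ _ MM] _] := properM.
split=> // x y _ _ Mxy; have [|nMx] := pselect (M x); first by left.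
have [z zx] := valuation_local hK properM TKM valT nMx.
by right; rewrite -(mul1r y) -zx -mulrA; apply: MM.
Qed.

Theorem theorem4p21 (T : idomainType) (K M D R : set T)
  (hK : subfield K)
  (hM : maximal_ideal [set: T] M)
  (hM0 : M <> [set 0])
  (hT : [set: T] = sumset K M)
  (hD : subring D)
  (hDK : D `<=` K)
  (hR : R = sumset D M) :
  (forall I : set T, ideal D I ->
     (sdf_absorbing_ideal R (sumset I M) <-> sdf_absorbing_ideal D I))
  /\
  (valuation_domain T ->
   forall J : set T, ideal R J ->
     (sdf_absorbing_ideal R J <->
      (exists I : set T, sdf_absorbing_ideal D I /\ J = sumset I M) \/
      prime_ideal [set: T] J)).
Proof.
have [properM _] := hM; have [idM _] := properM.
have partA I : ideal D I ->
    (sdf_absorbing_ideal R (sumset I M) <-> sdf_absorbing_ideal D I).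
  by move=> hI; rewrite hR; exact: (sumset_sdf_absorbing hK properM hD hDK hI).
split=> // valT J hJ.
have subringR : subring R by rewrite hR; exact: sumset_subring.
have MR : M `<=` R.
  by move=> m Mm; rewrite hR; exists 0; [exact: subring0|exists m; rewrite ?add0r].
split=> [sdfJ|[[I [sdfI ->]]|primeJ]]; last 2 first.
- by apply/partA => //; case: sdfI => -[].
- exact: prime_sdf_absorbing.
have [JM|MJ] := ideal_in_or_contains_max hK properM hT valT MR hJ.
  right; apply: (radical_sub_max_prime valT _ MR hJ JM).
    exact: (valuation_max_prime hK properM hT valT).
  by move=> x Rx; exact: (sdf_absorbing_radical subringR sdfJ).
left; exists (D `&` J); rewrite hR in hJ.
have [idI JE] := ideal_containing_max idM hD hJ MJ.
by split=> //; apply/partA => //; rewrite -JE.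
Qed.
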